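(* Consider problem $(\mathrm{QPI})$ (with $\Gamma=\mathbb R^N_+$) or problem $(\mathrm{QPE})$ (with $\Gamma=\mathbb R^N$), and suppose that the corresponding Slater condition holds: for $(\mathrm{QPI})$, for every $i\in\mathcal N$ there is $\hat x_i\in\mathbb R^{n_i}$ with $g_i(\hat x_i)<0$; for $(\mathrm{QPE})$, for every $i\in\mathcal N$ there are $\hat x_i^1,\hat x_i^2\in\mathbb R^{n_i}$ with $g_i(\hat x_i^1)<0$ and $g_i(\hat x_i^2)>0$. Suppose there exists $\boldsymbol\lambda\in\Gamma$ such that $A_0+\sum_{i\in\mathcal N}\lambda_iA_i\succ0$. Then the problem of maximizing $q(\boldsymbol\lambda)$ over $\boldsymbol\lambda\in\Gamma$ has a nonempty and compact solution set. Furthermore, the quadratic problem ($(\mathrm{QPI})$, respectively $(\mathrm{QPE})$) has a nonempty solution set.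
   Context: $\mathcal N=\{1,\dots,N\}$, $p=\sum_{i\in\mathcal N}n_i$, $\mathbf x=(x_i)_{i\in\mathcal N}\in\mathbb R^p$ with blocks $x_i\in\mathbb R^{n_i}$. $A_0\in\mathbb R^{p\times p}$ is symmetric, $b_0\in\mathbb R^p$, $c_0\in\mathbb R$; for each $i\in\mathcal N$, $\widetilde A_i\in\mathbb R^{n_i\times n_i}$ is symmetric, $\widetilde b_i\in\mathbb R^{n_i}$, $c_i\in\mathbb R$. No definiteness is assumed. Put $f(\mathbf x)=\mathbf x^TA_0\mathbf x+2b_0^T\mathbf x+c_0$ and $g_i(x_i)=x_i^T\widetilde A_ix_i+2\widetilde b_i^Tx_i+c_i$. $(\mathrm{QPI})$: minimize $f(\mathbf x)$ over $\mathbf x\in\mathbb R^p$ subject to $g_i(x_i)\le0$ for all $i\in\mathcal N$. $(\mathrm{QPE})$: minimize $f(\mathbf x)$ subject to $g_i(x_i)=0$ for all $i\in\mathcal N$. $A_i=\operatorname{diag}[0,\dots,\widetilde A_i,\dots,0]\in\mathbb R^{p\times p}$ (nonzero only in the $i$th diagonal block). The dual function is $q(\boldsymbol\lambda)=\inf_{\mathbf x\in\mathbb R^p}\big(f(\mathbf x)+\sum_{i\in\mathcal N}\lambda_ig_i(x_i)\big)\in[-\infty,\infty)$ for $\boldsymbol\lambda=(\lambda_i)_{i\in\mathcal N}\in\Gamma$. *)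

(* Defs.v *)
From HB Require Import structures.
From mathcomp Require Import all_boot all_order all_algebra.
From mathcomp Require Import all_classical all_reals all_analysis.
Set Implicit Arguments.
Unset Strict Implicit.
Unset Printing Implicit Defensive.
Import Order.TTheory GRing.Theory Num.Theory.
Import numFieldNormedType.Exports.
Local Open Scope classical_set_scope.
Local Open Scope ring_scope.

Definition posdefmx (R : realType) (m : nat) (A : 'M[R]_m) : Prop :=
  A \is symmetricmx /\ forall x : 'cV[R]_m, x != 0 -> 0 < (x^T *m A *m x) 0 0.

Definition quad (R : realType) (m : nat) (A : 'M[R]_m) (b : 'cV[R]_m) (c : R)
    (x : 'cV[R]_m) : R :=
  (x^T *m A *m x) 0 0 + 2 * (b^T *m x) 0 0 + c.

Definition minimizers (d : Order.disp_t) (V : porderType d) (X : Type)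
    (F : X -> V) (S : set X) : set X :=
  [set x | S x /\ forall y, S y -> (F x <= F y)%O].

Definition maximizers (d : Order.disp_t) (V : porderType d) (X : Type)
    (F : X -> V) (S : set X) : set X :=
  [set x | S x /\ forall y, S y -> (F y <= F x)%O].

(* A vector of R^p, p = \sum_i n i, is a column x : 'cV[R]_(\sum_i n i), and
   its i-th block x_i is submxcol x i : 'cV[R]_(n i). *)
Section BlockSeparable.
Variables (R : realType) (N : nat) (n : 'I_N -> nat).
Implicit Types (f : 'cV[R]_(\sum_i n i) -> R)
  (g : forall i : 'I_N, 'cV[R]_(n i) -> R).

Definition block_quad (At : forall i : 'I_N, 'M[R]_(n i))
    (bt : forall i : 'I_N, 'cV[R]_(n i)) (c : 'I_N -> R) (i : 'I_N)
    (x : 'cV[R]_(n i)) : R :=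
  quad (At i) (bt i) (c i) x.

Definition block_embed (At : forall i : 'I_N, 'M[R]_(n i)) (i : 'I_N) :
    'M[R]_(\sum_j n j) :=
  \mxdiag_(j < N) (if j == i then At j else 0).

Definition feasible_ineq g : set 'cV[R]_(\sum_i n i) :=
  [set x | forall i, g i (submxcol x i) <= 0].

Definition feasible_eq g : set 'cV[R]_(\sum_i n i) :=
  [set x | forall i, g i (submxcol x i) = 0].

Definition slater_ineq g : Prop :=
  forall i, exists x : 'cV[R]_(n i), g i x < 0.

Definition slater_eq g : Prop :=
  forall i, exists x1 x2 : 'cV[R]_(n i), g i x1 < 0 /\ 0 < g i x2.

Definition dual_fun f g (lambda : 'rV[R]_N) : \bar R :=
  ereal_inf (range (fun x : 'cV[R]_(\sum_i n i) =>
    (f x + \sum_(i < N) lambda 0 i * g i (submxcol x i))%:E)).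

End BlockSeparable.

Definition nonneg_orthant (R : realType) (N : nat) : set 'rV[R]_N :=
  [set lambda | forall i, 0 <= lambda 0 i].

(* Main.v *)
Require Import Defs.
From HB Require Import structures.
From mathcomp Require Import all_boot all_order all_algebra.
From mathcomp Require Import all_classical all_reals all_analysis.
From mathcomp Require Import finmap ring lra.
Set Implicit Arguments.
Unset Strict Implicit.
Unset Printing Implicit Defensive.
Import Order.TTheory GRing.Theory Num.Theory.
Import numFieldNormedType.Exports.
Local Open Scope classical_set_scope.
Local Open Scope ring_scope.

(* Fix l0 with A_0 + \sum_i l0_i A_i positive definite: the Lagrangian at l0 is
   a coercive quadratic function of x.  On the feasible set it is dominated by
   f, so the sublevel sets of f there are compact and f attains its minimum (for
   equality constraints feasibility itself is the intermediate value theorem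
   applied between the two Slater points of each block).  Coercivity also gives
   q(l0) > -oo.  Being an infimum of affine functions, q is upper
   semicontinuous, and evaluating the Lagrangian at a Slater point x with the
   right sign pattern gives q(l) <= C - \sum_i m_i |l_i|, so the superlevel set
   {q >= q(l0)} is compact; hence q attains its maximum on a compact set. *)

(** * Continuity of quadratics, and compactness of closed sets inside coordinate boxes *)

Lemma continuous_big_sum (R : realType) (T : topologicalType) (I : Type)
    (r : seq I) (F : I -> T -> R) :
  (forall i, continuous (F i)) -> continuous (fun t => \sum_(i <- r) F i t).
Proof.
move=> cF; elim: r => [|i r IH] t.
  by under eq_fun do rewrite big_nil; exact: cst_continuous.
under eq_fun do rewrite big_cons.
by apply: cvgD; [exact: cF|exact: IH].
Qed.

Lemma continuous_affine_comb (R : realType) (T : topologicalType) (I : Type)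
    (r : seq I) (F : I -> T -> R) (k : I -> R) (a : R) :
  (forall i, continuous (F i)) ->
  continuous (fun t => a + \sum_(i <- r) F i t * k i).
Proof.
move=> cF t; apply: cvgD; first exact: cvg_cst.
by apply: continuous_big_sum => i {}t; apply: cvgMl; exact: cF.
Qed.

(** Coordinatewise continuity of [h] suffices because the value is a polynomial in the coordinates.
    This form covers the identity, block projections and segments alike. *)
Lemma continuous_quad_comp (R : realType) (T : topologicalType) (m : nat)
    (A : 'M[R]_m) (b : 'cV[R]_m) (c : R) (h : T -> 'cV[R]_m) :
  (forall i, continuous (fun t => h t i 0)) ->
  continuous (fun t => quad A b c (h t)).
Proof.
move=> ch.
have -> : (fun t => quad A b c (h t)) = (fun t =>
    \sum_j (\sum_i (h t i 0 * A i j)) * h t j 0 +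
    2 * (\sum_i b i 0 * h t i 0) + c).
  apply/funext => t; rewrite /quad; congr (_ + 2 * _ + _).
    rewrite mxE; apply: eq_bigr => j _; rewrite mxE; congr (_ * _).
    by apply: eq_bigr => i _; rewrite mxE.
  by rewrite mxE; apply: eq_bigr => i _; rewrite mxE.
move=> t; apply: cvgD; last exact: cvg_cst.
apply: cvgD.
  apply: continuous_big_sum => j {}t; apply: cvgM; last exact: ch.
  by apply: continuous_big_sum => i {}t; apply: cvgMl; exact: ch.
apply: cvgMr; apply: continuous_big_sum => i {}t.
by apply: cvgMr; exact: ch.
Qed.

Lemma continuous_quad (R : realType) (m : nat) (A : 'M[R]_m) (b : 'cV[R]_m)
  (c : R) : continuous (quad A b c).
Proof.
apply: (@continuous_quad_comp _ _ _ _ _ _ id) => i; exact: coord_continuous.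
Qed.

Lemma continuous_trmx (R : realType) (m n : nat) :
  continuous (fun x : 'M[R]_(m, n) => x^T).
Proof.
move=> x U [P Px PU]; exists (fun i j => P j i) => [i j|y Py].
  by have := Px j i; rewrite mxE.
by apply: PU => i j; rewrite mxE; exact: Py.
Qed.

Lemma closed_box_compact_row (R : realType) (n : nat) (C : 'I_n -> R)
    (A : set 'rV[R]_n) :
  closed A -> (forall x, A x -> forall i, `|x 0 i| <= C i) -> compact A.
Proof.
move=> clA boxA.
pose I i : set R := `[- C i, C i]%classic.
have cB : compact [set x : 'rV[R]_n | forall i, I i (x ord0 i)].
  by apply: rV_compact => i; exact: segment_compact.
apply: subclosed_compact clA cB _ => x Ax i /=.
by rewrite /I /= in_itv /= -ler_norml; exact: boxA.
Qed.

(** Transposition is continuous, so compactness carries over from rows, where it comes from a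
    product of segments. *)
Lemma closed_box_compact_col (R : realType) (n : nat) (C : 'I_n -> R)
    (A : set 'cV[R]_n) :
  closed A -> (forall x, A x -> forall i, `|x i 0| <= C i) -> compact A.
Proof.
move=> clA boxA.
have -> : A = trmx @` [set y : 'rV[R]_n | A y^T].
  apply/seteqP; split => [x Ax|_ [y Ay <-]//].
  by exists x^T => //=; rewrite trmxK.
apply: continuous_compact; first exact/continuous_subspaceT/continuous_trmx.
apply: (@closed_box_compact_row _ _ C) => [|y Ay i].
  by apply: preimage_closed clA => y _; exact: continuous_trmx.
by have := boxA _ Ay i; rewrite mxE.
Qed.

Lemma continuous_closed_le (R : realType) (T : topologicalType) (f : T -> R)
  (v : R) : continuous f -> closed [set x | f x <= v].
Proof.
by move=> cf; apply: (preimage_closed _ (@closed_le _ v)) => x _; exact: cf.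
Qed.

Lemma continuous_closed_ge (R : realType) (T : topologicalType) (f : T -> R)
  (v : R) : continuous f -> closed [set x | v <= f x].
Proof.
by move=> cf; apply: (preimage_closed _ (@closed_ge _ v)) => x _; exact: cf.
Qed.

Lemma continuous_closed_eq (R : realType) (T : topologicalType) (f : T -> R)
  (v : R) : continuous f -> closed [set x | f x = v].
Proof.
by move=> cf; apply: (preimage_closed _ (@closed_eq _ v)) => x _; exact: cf.
Qed.

(** * Positive definite forms, coercivity, and maxima of upper semicontinuous functions *)

Lemma scaled_form (R : realType) (m : nat) (A : 'M[R]_m) (k : R)
    (x : 'cV[R]_m) :
  ((k *: x)^T *m A *m (k *: x)) 0 0 = k ^+ 2 * (x^T *m A *m x) 0 0.
Proof.
by rewrite -scalemxAr [(k *: x)^T]linearZ /= -!scalemxAl scalerA [LHS]mxE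
  -expr2.
Qed.

Lemma form1_sqr_sum (R : realType) (m : nat) (x : 'cV[R]_m) :
  (x^T *m 1%:M *m x) 0 0 = \sum_i x i 0 ^+ 2.
Proof.
by rewrite mulmx1 mxE; apply: eq_bigr => i _; rewrite mxE -expr2.
Qed.

Lemma ler_coord_sqr_sum (R : realType) (m : nat) (x : 'cV[R]_m) (i : 'I_m) :
  x i 0 ^+ 2 <= \sum_j x j 0 ^+ 2.
Proof.
by rewrite (bigD1 i) //= lerDl sumr_ge0 // => j _; exact: sqr_ge0.
Qed.

(** Expanding [(|t| - 1)^2 >= 0] gives [2|t| <= 1 + t^2]. This crude bound turns control of the sum
    of squares into a coordinate box without square roots. *)
Lemma ler_norm_sqr_sum (R : realType) (m : nat) (x : 'cV[R]_m) (i : 'I_m) :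
  `|x i 0| <= 1 + \sum_j x j 0 ^+ 2.
Proof.
apply: le_trans (_ : 1 + x i 0 ^+ 2 <= _); last first.
  by rewrite lerD2l ler_coord_sqr_sum.
rewrite -real_normK ?num_real //; have := sqr_ge0 (`|x i 0| - 1).
have := normr_ge0 (x i 0); nra.
Qed.

Lemma sqr_sum_eq0 (R : realType) (m : nat) (x : 'cV[R]_m) :
  \sum_i x i 0 ^+ 2 = 0 -> x = 0.
Proof.
move=> s0; apply/colP => i; rewrite mxE; apply/eqP; rewrite -sqrf_eq0.
by rewrite eq_le sqr_ge0 -s0 ler_coord_sqr_sum.
Qed.

Lemma continuous_sqr_sum (R : realType) (m : nat) :
  continuous (fun x : 'cV[R]_m => \sum_i x i 0 ^+ 2).
Proof.
apply: continuous_big_sum => i; under eq_fun do rewrite expr2.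
have ci : continuous (fun x : 'cV[R]_m => x i 0) by exact: coord_continuous.
by move=> x; exact: (continuousM (ci x) (ci x)).
Qed.

(* The constant is the minimum of the form over the Euclidean unit sphere. *)
Lemma posdefmx_ge_sqr_sum (R : realType) (m : nat) (A : 'M[R]_m) :
  posdefmx A -> exists2 a : R, 0 < a &
    forall x : 'cV[R]_m, a * \sum_i x i 0 ^+ 2 <= (x^T *m A *m x) 0 0.
Proof.
move=> [_ pdA].
pose S : set 'cV[R]_m := [set x | \sum_i x i 0 ^+ 2 = 1].
have normalized (x : 'cV[R]_m) : x != 0 ->
    exists k : R, [/\ 0 < k, k ^+ 2 = \sum_i x i 0 ^+ 2 & S (k^-1 *: x)].
  move=> x0; set s := \sum_i _; exists (Num.sqrt s).
  have s0 : 0 <= s by apply: sumr_ge0 => i _; exact: sqr_ge0.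
  have sp : 0 < s.
    rewrite lt_neqAle s0 andbT eq_sym; apply: contra_neq x0.
    exact: sqr_sum_eq0.
  split; rewrite ?sqrtr_gt0 ?sqr_sqrtr //.
  rewrite /S /= -form1_sqr_sum scaled_form form1_sqr_sum exprVn.
  by rewrite sqr_sqrtr // mulVf // gt_eqF.
have cS : compact S.
  apply: (@closed_box_compact_col _ _ (fun=> 1 + 1)) => [|x /= Sx i].
    by apply: continuous_closed_eq; exact: continuous_sqr_sum.
  by rewrite -{2}Sx ler_norm_sqr_sum.
(* In dimension 0 the sphere is empty. Every vector is then zero, since a nonzero one could be
   normalized, and the constant 1 works. *)
have [[y0 Sy0]|/set0P/negP/negPn/eqP S0] := pselect (S !=set0); last first.
  exists 1 => // x; have [->|x0] := eqVneq x 0.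
    by rewrite mulmx0 mxE big1 ?mulr0 // => i _; rewrite mxE expr0n.
  by have [k [_ _]] := normalized _ x0; rewrite S0.
have cA : continuous (fun x : 'cV[R]_m => (x^T *m A *m x) 0 0).
  rewrite [X in continuous X](_ : _ = quad A 0 0); first exact: continuous_quad.
  by apply/funext => x; rewrite /quad trmx0 mul0mx [X in _ + 2 * X + _]mxE
    mulr0 !addr0.
have [|y /set_mem Sy miny] := compact_EVT_min _ cS (continuous_subspaceT cA).
  by exists y0.
exists ((y^T *m A *m y) 0 0).
  apply: pdA; apply/eqP => y00; move: Sy; rewrite y00 /S /=.
  by rewrite big1 => [/eqP|i _]; rewrite ?mxE ?expr0n // eq_sym oner_eq0.
move=> x; have [->|x0] := eqVneq x 0.
  by rewrite mulmx0 [leRHS]mxE big1 ?mulr0 // => i _; rewrite mxE expr0n.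
(* By homogeneity the form at [k^-1 *: x] is its value at [x] divided by [k^2], the sum of squares
   of [x]. *)
have [k [k0 <- Sx]] := normalized _ x0.
have := miny _ (mem_set Sx); rewrite scaled_form exprVn.
by rewrite [_^-1 * _]mulrC ler_pdivlMr ?exprn_gt0.
Qed.

(** Half of the quadratic growth absorbs the linear term, at the price of a constant. *)
Lemma posdef_quad_coercive (R : realType) (m : nat) (A : 'M[R]_m)
    (b : 'cV[R]_m) (c : R) : posdefmx A ->
  exists a K : R, 0 < a /\
    forall x : 'cV[R]_m, a * \sum_i x i 0 ^+ 2 - K <= quad A b c x.
Proof.
move=> /posdefmx_ge_sqr_sum [a a0 ha].
exists (a / 2), (2 / a * \sum_i b i 0 ^+ 2 - c).
split=> [|x]; first by rewrite divr_gt0.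
(* Young: [- 2 b_i x_i <= (a / 2) x_i ^ 2 + (2 / a) b_i ^ 2] *)
have young : - (a / 2 * \sum_i x i 0 ^+ 2 + 2 / a * \sum_i b i 0 ^+ 2)
    <= 2 * (b^T *m x) 0 0.
  rewrite mxE !mulr_sumr -big_split -sumrN; apply: ler_sum => i _ /=.
  rewrite mxE -subr_ge0.
  suff -> : 2 * (b i 0 * x i 0) - - (a / 2 * x i 0 ^+ 2 + 2 / a * b i 0 ^+ 2)
      = (a * x i 0 + 2 * b i 0) ^+ 2 / (2 * a).
    by rewrite divr_ge0 ?sqr_ge0 // mulr_ge0 // ltW.
  by field; rewrite gt_eqF.
have := ha x; rewrite /quad; lra.
Qed.

(** Weierstrass for upper semicontinuous [q], by the finite intersection property: the superlevel
    sets at the values of [q] on [K] are closed, and finitely many always meet in [K]. An arbitrary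
    total order as codomain admits extended real values. *)
Lemma maximizers_compact (d : Order.disp_t) (V : orderType d)
    (T : ptopologicalType) (q : T -> V) (S : set T) (x0 : T) :
  S x0 -> compact [set x | S x /\ (q x0 <= q x)%O] ->
  (forall v, closed [set x | (v <= q x)%O]) ->
  maximizers q S !=set0 /\ compact (maximizers q S).
Proof.
move=> Sx0 cK clq; set K := [set x | _ /\ _] in cK.
have finmax (s : seq T) : {in s, forall x, K x} ->
    exists2 y, K y & {in s, forall x, (q x <= q y)%O}.
  elim: s => [_|x s IH sK]; first by exists x0 => //; split.
  have [z zs|y Ky maxy] := IH; first by apply: sK; rewrite inE zs orbT.
  have Kx : K x by apply: sK; rewrite mem_head.
  have [xy|yx] := leP (q x) (q y).
    by exists y => // z; rewrite inE => /predU1P[->|/maxy].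
  exists x => // z; rewrite inE => /predU1P[->//|/maxy zy].
  exact: le_trans zy (ltW yx).
have [y maxy] : \bigcap_(x in K) [set y | K y /\ (q x <= q y)%O] !=set0.
  move: (cK); rewrite compact_In0; apply.
    by exists (fun x => [set y | (q x <= q y)%O]).
  move=> D DK; have [|y Ky maxy] := finmax D; first by move=> x /DK /set_mem.
  by exists y => x /= xD; split => //; exact: maxy.
have [[Sy q0y] _] := maxy x0 (conj Sx0 (lexx _)).
(* Points of [S] outside [K] have values below [q x0], hence below [q y]. *)
have maxS x : S x -> (q x <= q y)%O.
  have [x0x Sx|xx0 _] := leP (q x0) (q x); last first.
    exact: ltW (lt_le_trans xx0 q0y).
  by have [] := maxy x (conj Sx x0x).
split; first by exists y.
rewrite (_ : maximizers q S = K `&` [set x | (q y <= q x)%O]).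
  exact: compact_closedI.
apply/seteqP; split => [x [Sx maxx]|x [[Sx _] yx]].
  by split; [split => //; exact: maxx|exact: maxx].
by split => // z /maxS zy; exact: le_trans yx.
Qed.

(** * Lagrangian, dual function and weak duality *)

Section BlockDual.
Variables (R : realType) (N : nat) (n : 'I_N -> nat).
Variables (f : 'cV[R]_(\sum_i n i) -> R)
  (g : forall i : 'I_N, 'cV[R]_(n i) -> R).

Definition lagrangian (lambda : 'rV[R]_N) (x : 'cV[R]_(\sum_i n i)) : R :=
  f x + \sum_(i < N) lambda 0 i * g (submxcol x i).

Lemma continuous_lagrangian (x : 'cV[R]_(\sum_i n i)) :
  continuous (lagrangian ^~ x).
Proof.
apply: continuous_affine_comb => i; exact: coord_continuous.
Qed.

Lemma dual_fun_le (lambda : 'rV[R]_N) (x : 'cV[R]_(\sum_i n i)) :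
  (dual_fun f g lambda <= (lagrangian lambda x)%:E)%E.
Proof. by apply: ereal_inf_lbound; exists x. Qed.

(** An infimum is at least [v] exactly when every member is, so the set is an intersection of
    superlevel sets of functions affine in the multipliers. *)
Lemma closed_dual_superlevel (v : \bar R) :
  closed [set lambda | (v <= dual_fun f g lambda)%E].
Proof.
rewrite (_ : mkset _ =
    \bigcap_x [set l | (v <= (lagrangian l x)%:E)%E]); last first.
  apply/seteqP; split => [l vl x _|l vl].
    exact: le_trans (dual_fun_le _ _).
  by apply/ereal_infP => _ [x _ <-]; exact: vl.
apply: closed_bigI => x _; case: v => [r||].
- rewrite (_ : mkset _ = [set l | r <= lagrangian l x]).
    exact/continuous_closed_ge/continuous_lagrangian.
  by apply/funext => l /=; rewrite lee_fin.
- rewrite (_ : mkset _ = set0); first exact: closed0.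
  by apply/funext => l /=; rewrite leye_eq; apply/propext; split.
- rewrite (_ : mkset _ = setT); first exact: closedT.
  by apply/funext => l /=; rewrite leNye; apply/propext.
Qed.

(* The last hypothesis is what the Slater points provide: they make the dual
   function decrease at least linearly in every |lambda_i|. *)
Lemma dual_maximizers_compact (G : set 'rV[R]_N) (l0 : 'rV[R]_N) (K C : R)
    (m : 'I_N -> R) :
  closed G -> G l0 -> (forall x, K <= lagrangian l0 x) ->
  (forall i, 0 < m i) ->
  (forall l, G l -> exists2 x, f x <= C &
    forall i, l 0 i * g (submxcol x i) <= - (m i * `|l 0 i|)) ->
  maximizers (dual_fun f g) G !=set0 /\
  compact (maximizers (dual_fun f g) G).
Proof.
move=> clG Gl0 lbK m0 slater; apply: (maximizers_compact Gl0).
  (* The box comes from [K <= q(l0) <= q(l) <= L(l, x) <= C - m_i |l_i|], where [L] is the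
     Lagrangian and the terms of the other blocks are dropped as nonpositive. *)
  apply: (@closed_box_compact_row _ _ (fun i => (C - K) / m i)).
    by apply: closedI => //; exact: closed_dual_superlevel.
  move=> l [Gl l0l] i; rewrite ler_pdivlMr //.
  have [x fx gx] := slater _ Gl.
  have : (K%:E <= (lagrangian l x)%:E)%E.
    apply: le_trans (le_trans l0l (dual_fun_le _ _)).
    by apply/ereal_infP => _ [y _ <-]; rewrite lee_fin; exact: lbK.
  rewrite lee_fin /lagrangian (bigD1 i) //=.
  have := gx i.
  suff : \sum_(j < N | j != i) l 0 j * g (submxcol x j) <= 0 by lra.
  apply: sumr_le0 => j _; apply: le_trans (gx j) _.
  by rewrite oppr_le0 mulr_ge0 // ltW.
exact: closed_dual_superlevel.
Qed.

(* Weak duality: on S the objective dominates the coercive Lagrangian. *)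
Lemma primal_minimizers_exist (S : set 'cV[R]_(\sum_i n i)) (l0 : 'rV[R]_N)
    (a K : R) :
  closed S -> S !=set0 -> continuous f -> 0 < a ->
  (forall x : 'cV_(\sum_i n i), a * \sum_i x i 0 ^+ 2 - K <= lagrangian l0 x) ->
  (forall x, S x -> forall i, l0 0 i * g (submxcol x i) <= 0) ->
  minimizers f S !=set0.
Proof.
move=> clS [x0 Sx0] cf a0 coercive signS.
pose B := S `&` [set x | f x <= f x0].
have fL x : S x -> a * \sum_i x i 0 ^+ 2 - K <= f x.
  move=> Sx; apply: le_trans (coercive x) _; rewrite /lagrangian gerDl.
  by apply: sumr_le0 => i _; exact: signS.
have cB : compact B.
  (* On [B], [fL] bounds the sum of squares by [(f x0 + K) / a]. *)
  apply: (@closed_box_compact_col _ _ (fun=> 1 + (f x0 + K) / a)).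
    by apply: closedI => //; exact: continuous_closed_le.
  move=> x [Sx fx] i; apply: le_trans (ler_norm_sqr_sum _ _) _.
  rewrite lerD2l ler_pdivlMr //; have := fL _ Sx.
  move: fx => /=; rewrite mulrC; lra.
have [|y /set_mem [Sy fy] miny] :=
    compact_EVT_min _ cB (continuous_subspaceT cf).
  by exists x0; split => //=.
exists y; split => // x Sx.
have [xx0|/ltW x0x] := leP (f x) (f x0); first by apply: miny; apply/mem_set.
exact: le_trans x0x.
Qed.

End BlockDual.

(** * Block-separable quadratic data *)

Section SeparableQuadratic.
Variables (R : realType) (N : nat) (n : 'I_N -> nat).
Variables (At : forall i : 'I_N, 'M[R]_(n i))
  (bt : forall i : 'I_N, 'cV[R]_(n i)).
Variable c : 'I_N -> R.

Lemma block_embed_form (i : 'I_N) (x : 'cV[R]_(\sum_i n i)) :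
  x^T *m block_embed At i *m x = (submxcol x i)^T *m At i *m submxcol x i.
Proof.
rewrite -mulmxA /block_embed -{1 2}(submxcolK x) tr_mxcol mul_mxdiag_mxcol.
rewrite mul_mxrow_mxcol (bigD1 i) //= eqxx big1 ?addr0 ?mulmxA // => j ji.
by rewrite (negbTE ji) mul0mx mulmx0.
Qed.

(** Exhibits the matrix assumed positive definite as the quadratic part of the Lagrangian, so that
    coercivity applies to it. *)
Lemma lagrangian_quad (A0 : 'M[R]_(\sum_i n i)) (b0 : 'cV[R]_(\sum_i n i))
    (c0 : R) (l : 'rV[R]_N) (x : 'cV[R]_(\sum_i n i)) :
  lagrangian (quad A0 b0 c0) (block_quad At bt c) l x =
  quad (A0 + \sum_(i < N) l 0 i *: block_embed At i)
    (b0 + \mxcol_i (l 0 i *: bt i)) (c0 + \sum_(i < N) l 0 i * c i) x.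
Proof.
rewrite /lagrangian /block_quad /quad.
have -> : (x^T *m (A0 + \sum_i l 0 i *: block_embed At i) *m x) 0 0 =
    (x^T *m A0 *m x) 0 0 +
    \sum_i l 0 i * ((submxcol x i)^T *m At i *m submxcol x i) 0 0.
  rewrite mulmxDr mulmxDl mxE; congr (_ + _).
  rewrite mulmx_sumr mulmx_suml summxE; apply: eq_bigr => i _.
  by rewrite -scalemxAr -scalemxAl mxE block_embed_form.
have -> : ((b0 + \mxcol_i (l 0 i *: bt i))^T *m x) 0 0 =
    (b0^T *m x) 0 0 + \sum_i l 0 i * ((bt i)^T *m submxcol x i) 0 0.
  rewrite linearD /= mulmxDl mxE; congr (_ + _).
  rewrite -{1}(submxcolK x) tr_mxcol mul_mxrow_mxcol summxE.
  by apply: eq_bigr => i _; rewrite linearZ /= -scalemxAl mxE.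
have -> : \sum_i l 0 i * (((submxcol x i)^T *m At i *m submxcol x i) 0 0 +
      2 * ((bt i)^T *m submxcol x i) 0 0 + c i) =
    \sum_i l 0 i * ((submxcol x i)^T *m At i *m submxcol x i) 0 0 +
    2 * (\sum_i l 0 i * ((bt i)^T *m submxcol x i) 0 0) +
    \sum_i l 0 i * c i.
  rewrite mulr_sumr -!big_split; apply: eq_bigr => i _ /=; ring.
ring.
Qed.

Lemma continuous_block_quad (i : 'I_N) :
  continuous (fun x : 'cV[R]_(\sum_i n i) => block_quad At bt c (submxcol x i)).
Proof.
apply: continuous_quad_comp => k.
(* [tagnat.Rank i k] is the position in the full vector of coordinate [k] of block [i]. *)
rewrite [X in continuous X](_ : _ =
    fun x : 'cV[R]_(\sum_i n i) => x (tagnat.Rank i k) 0).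
  exact: coord_continuous.
by apply/funext => x; rewrite mxE.
Qed.

Lemma closed_feasible_ineq : closed (feasible_ineq (block_quad At bt c)).
Proof.
rewrite (_ : feasible_ineq _ =
    \bigcap_i [set x | block_quad At bt c (submxcol x i) <= 0]); last first.
  by apply/seteqP; split => [x xS i _|x xS i]; [exact: xS|exact: (xS i I)].
by apply: closed_bigI => i _; apply/continuous_closed_le/continuous_block_quad.
Qed.

Lemma closed_feasible_eq : closed (feasible_eq (block_quad At bt c)).
Proof.
rewrite (_ : feasible_eq _ =
    \bigcap_i [set x | block_quad At bt c (submxcol x i) = 0]); last first.
  by apply/seteqP; split => [x xS i _|x xS i]; [exact: xS|exact: (xS i I)].
by apply: closed_bigI => i _; apply/continuous_closed_eq/continuous_block_quad.
Qed.

End SeparableQuadratic.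

(** * Feasibility under equality constraints, and the two existence results *)

Lemma quad_IVT (R : realType) (m : nat) (A : 'M[R]_m) (b : 'cV[R]_m) (c : R)
    (x y : 'cV[R]_m) :
  quad A b c x <= 0 -> 0 <= quad A b c y -> exists z, quad A b c z = 0.
Proof.
move=> qx qy; pose h (t : R) := x + t *: (y - x).
have ch : continuous (fun t => quad A b c (h t)).
  apply: continuous_quad_comp => i t; rewrite /h.
  under eq_fun do rewrite !mxE.
  by apply: cvgD; [exact: cvg_cst|apply: cvgMl; exact: cvg_id].
have h0 : h 0 = x by rewrite /h scale0r addr0.
have h1 : h 1 = y by rewrite /h scale1r addrC subrK.
have [|t _ ht] := IVT (v := 0) ler01 (continuous_subspaceT ch).
  by rewrite h0 h1 ge_min qx le_max qy orbT.
by exists (h t).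
Qed.

(** Common core of both problems: [G] is the multiplier set and [S] the feasible set. The sign
    condition on [S] yields weak duality at [l0]; the test points, with [C] and [m] uniform in [l],
    encode the Slater condition. *)
Lemma separable_qp_attained (R : realType) (N : nat) (n : 'I_N -> nat)
    (A0 : 'M[R]_(\sum_i n i)) (b0 : 'cV[R]_(\sum_i n i)) (c0 : R)
    (At : forall i : 'I_N, 'M[R]_(n i)) (bt : forall i : 'I_N, 'cV[R]_(n i))
    (c : 'I_N -> R) (G : set 'rV[R]_N) (S : set 'cV[R]_(\sum_i n i))
    (l0 : 'rV[R]_N) (C : R) (m : 'I_N -> R) :
  let f := quad A0 b0 c0 in let g := block_quad At bt c in
  closed G -> closed S -> S !=set0 -> G l0 ->
  posdefmx (A0 + \sum_(i < N) l0 0 i *: block_embed At i) ->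
  (forall x, S x -> forall i, l0 0 i * g i (submxcol x i) <= 0) ->
  (forall i, 0 < m i) ->
  (forall l, G l -> exists2 x, f x <= C &
    forall i, l 0 i * g i (submxcol x i) <= - (m i * `|l 0 i|)) ->
  [/\ maximizers (dual_fun f g) G !=set0,
      compact (maximizers (dual_fun f g) G) & minimizers f S !=set0].
Proof.
move=> f g clG clS S0 Gl0 pdM signS m0 slater.
have [a [K [a0 coercive]]] :=
  posdef_quad_coercive (b0 + \mxcol_i (l0 0 i *: bt i))
    (c0 + \sum_(i < N) l0 0 i * c i) pdM.
have {}coercive (x : 'cV[R]_(\sum_i n i)) :
    a * \sum_i x i 0 ^+ 2 - K <= lagrangian f g l0 x.
  by rewrite lagrangian_quad; exact: coercive.
have lower x : - K <= lagrangian f g l0 x.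
  apply: le_trans (coercive x); rewrite lerDr mulr_ge0 ?(ltW a0) //.
  by apply: sumr_ge0 => i _; exact: sqr_ge0.
have [? ?] := dual_maximizers_compact clG Gl0 lower m0 slater.
split=> //; apply: primal_minimizers_exist clS S0 _ a0 coercive signS.
exact: continuous_quad.
Qed.

Lemma closed_nonneg_orthant (R : realType) (N : nat) :
  closed (@nonneg_orthant R N).
Proof.
rewrite (_ : @nonneg_orthant R N =
    \bigcap_i [set l : 'rV[R]_N | 0 <= l 0 i]); last first.
  by apply/seteqP; split => [l l0 i _|l l0 i]; [exact: l0|exact: (l0 i I)].
apply: closed_bigI => i _.
apply: continuous_closed_ge; exact: (@coord_continuous R 1 N 0 i).
Qed.

Theorem corollary1 (R : realType) (N : nat) (n : 'I_N -> nat)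
  (A0 : 'M[R]_(\sum_i n i)) (b0 : 'cV[R]_(\sum_i n i)) (c0 : R)
  (At : forall i : 'I_N, 'M[R]_(n i)) (bt : forall i : 'I_N, 'cV[R]_(n i))
  (c : 'I_N -> R)
  (symA0 : A0 \is symmetricmx) (symAt : forall i, At i \is symmetricmx) :
  (slater_ineq (block_quad At bt c) ->
   (exists lambda : 'rV[R]_N, nonneg_orthant lambda /\
      posdefmx (A0 + \sum_(i < N) lambda 0 i *: block_embed At i)) ->
   [/\ maximizers (dual_fun (quad A0 b0 c0) (block_quad At bt c))
         (@nonneg_orthant R N) !=set0,
       compact (maximizers (dual_fun (quad A0 b0 c0) (block_quad At bt c))
         (@nonneg_orthant R N))
     & minimizers (quad A0 b0 c0)
         (feasible_ineq (block_quad At bt c)) !=set0])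
  /\
  (slater_eq (block_quad At bt c) ->
   (exists lambda : 'rV[R]_N,
      posdefmx (A0 + \sum_(i < N) lambda 0 i *: block_embed At i)) ->
   [/\ maximizers (dual_fun (quad A0 b0 c0) (block_quad At bt c))
         [set: 'rV[R]_N] !=set0,
       compact (maximizers (dual_fun (quad A0 b0 c0) (block_quad At bt c))
         [set: 'rV[R]_N])
     & minimizers (quad A0 b0 c0)
         (feasible_eq (block_quad At bt c)) !=set0]).
Proof.
set f := quad A0 b0 c0; set g := block_quad At bt c.
split=> slater [l0].
- move=> [l0_ge0 pdM]; pose xh i := sval (cid (slater i)).
  have gxh i : g i (xh i) < 0 := svalP (cid (slater i)).
  (* Multipliers are nonnegative, so the single stacked Slater point serves them all, with equality
     in the decay estimate. *)
  apply: (@separable_qp_attained _ _ _ _ _ _ _ _ _ _ _ l0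
      (f (\mxcol_i xh i)) (fun i => - g i (xh i))) => //.
  + exact: closed_nonneg_orthant.
  + exact: closed_feasible_ineq.
  + by exists (\mxcol_i xh i) => i; rewrite mxcolK ltW.
  + by move=> x xS i; rewrite mulr_ge0_le0 //; exact: xS.
  + by move=> i; rewrite oppr_gt0.
  + move=> l l_ge0; exists (\mxcol_i xh i) => // i.
    by rewrite mxcolK ger0_norm // mulNr opprK mulrC.
- move=> pdM.
  pose xn i := sval (cid (slater i)).
  pose xp i := sval (cid (svalP (cid (slater i)))).
  have [gxn gxp] : (forall i, g i (xn i) < 0) /\ (forall i, 0 < g i (xp i)).
    by split=> i; have [] := svalP (cid (svalP (cid (slater i)))).
  have zP i : exists z, g i z = 0.
    by apply: quad_IVT (ltW (gxn i)) (ltW (gxp i)).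
  (* one test point for each sign pattern of the multipliers *)
  pose xs (s : {ffun 'I_N -> bool}) := \mxcol_i (if s i then xn i else xp i).
  (* There are finitely many sign patterns, so the sum of [|f|] over them bounds [f] at each test
     point; the minimum gives a decay rate valid for either sign. *)
  apply: (@separable_qp_attained _ _ _ _ _ _ _ _ _ _ _ l0
      (\sum_s `|f (xs s)|)
      (fun i => Num.min (- g i (xn i)) (g i (xp i)))) => //.
  + exact: closed_feasible_eq.
  + by exists (\mxcol_i sval (cid (zP i))) => i; rewrite mxcolK;
      exact: (svalP (cid (zP i))).
  + by move=> x xS i; rewrite [X in _ * X](xS i) mulr0.
  + by move=> i; rewrite lt_min oppr_gt0 gxn gxp.
  (* The pattern picks in each block the Slater point where [g i] has sign opposite to [l 0 i]; a
     zero multiplier may take either. *)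
  + move=> l _; pose s := [ffun i => 0 <= l 0 i]; exists (xs s) => [|i].
      apply: le_trans (ler_norm _) _; rewrite (bigD1 s) //= lerDl.
      by apply: sumr_ge0.
    rewrite mxcolK ffunE.
    set a := - g i (xn i); set b := g i (xp i).
    have [l_ge0|l_lt0] := leP 0 (l 0 i).
      rewrite ger0_norm // lerNr -mulrN mulrC ler_wpM2l //.
      by rewrite ge_min lexx.
    rewrite ltr0_norm // mulrN opprK mulrC ler_wnM2r ?(ltW l_lt0) //.
    by rewrite ge_min lexx orbT.
Qed.
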